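(* For a family $\overline{\mathbf U}=\{\overline{\mathbf U}_K\}_{K\in\mathcal T_h}$ of cell averages with $\overline{\mathbf U}_K\in G_u$ for all $K$, and fixed $\Delta t>0$, let $$\mathcal S_h(\overline{\mathbf U}):=\Big\{\overline{\mathbf U}_K+\Delta t\,\mathbf L_K\big(\Pi_h\mathcal R_h^k\overline{\mathbf U}\big)\Big\}_{K\in\mathcal T_h}$$ be the single-step numerical evolution operator of the scheme ($k=2$, with characteristic WENO reconstruction $\mathcal R_h^k$, limiter $\Pi_h$ taken with $\varepsilon_D=\varepsilon_g=0$, and HLL finite volume operator $\mathbf L_K$). Then for any constant $\zeta>0$, $$\frac1\zeta\,\mathcal S_h(\zeta\overline{\mathbf U})=\mathcal S_h(\overline{\mathbf U}).$$
   Context: **RHD variables.** Fix $\Gamma\in(1,2]$. $\|\cdot\|$ is the Euclidean norm on $\mathbb R^2$. Primitive vectors are $\mathbf W=(\rho,\boldsymbol v,p)^\top\in\mathbb R^4$, $\boldsymbol v=(v_1,v_2)$. Put $\gamma=(1-\|\boldsymbol v\|^2)^{-1/2}$ and $H=1+\frac{\Gamma}{\Gamma-1}\frac p\rho$. The associated conservative vector $\mathbf U=(D,\boldsymbol m,E)^\top$ is $D=\rho\gamma$, $\boldsymbol m=\rho H\gamma^2\boldsymbol v$, $E=\rho H\gamma^2-p$. Given $\mathbf U$, $p(\mathbf U)$ is the solution $p\in[0,\infty)$ of $\frac{p}{\Gamma-1}-E+\frac{\|\boldsymbol m\|^2}{E+p}+D\sqrt{1-\frac{\|\boldsymbol m\|^2}{(E+p)^2}}=0$,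 and $\boldsymbol v(\mathbf U)=\boldsymbol m/(E+p(\mathbf U))$, $\rho(\mathbf U)=D\sqrt{1-\|\boldsymbol v(\mathbf U)\|^2}$. $G_u=\{\mathbf U\in\mathbb R^4:\rho(\mathbf U)>0,p(\mathbf U)>0,\|\boldsymbol v(\mathbf U)\|<1\}$; it is known that $G_u=\{\mathbf U:D>0,\ g(\mathbf U)>0\}$ with $g(\mathbf U)=E-\sqrt{D^2+\|\boldsymbol m\|^2}$. For $\mathbf U\in G_u$, $\rho,\boldsymbol v,p,\gamma,H$ are those recovered from $\mathbf U$. **Fluxes, eigenvalues, eigenvectors.** $\mathbf F_1=(Dv_1,m_1v_1+p,m_2v_1,m_1)^\top$, $\mathbf F_2=(Dv_2,m_1v_2,m_2v_2+p,m_2)^\top$; for a unit vector $\mathbf n=(n_1,n_2)$, $\mathbf n\cdot\mathbf F=n_1\mathbf F_1+n_2\mathbf F_2$. $c_s=\sqrt{\Gamma p/(\rho H)}$, $v_{\mathbf n}=v_1n_1+v_2n_2$, $v_\tau=v_2n_1-v_1n_2$, $$\lambda^{(1)}_{\mathbf n},\lambda^{(4)}_{\mathbf n}=\frac{v_{\mathbf n}(1-c_s^2)\mp c_s\gamma^{-1}\sqrt{1-v_{\mathbf n}^2-(\|\boldsymbol v\|^2-v_{\mathbf n}^2)c_s^2}}{1-\|\boldsymbol v\|^2c_s^2}$$ (minus for (1), plus for (4)). $\mathbf R_{\mathbf n}(\mathbf U)$ is the invertible matrix with columns, for $z\in\{1,4\}$, $\mathbf R^{(z)}=\big(\gamma(v_{\mathbf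 n}\lambda^{(z)}_{\mathbf n}-1),\ H\gamma^2(\lambda^{(z)}_{\mathbf n}(v_{\mathbf n}v_1-n_1)+v_\tau n_2),\ H\gamma^2(\lambda^{(z)}_{\mathbf n}(v_{\mathbf n}v_2-n_2)-v_\tau n_1),\ H\gamma^2(v_{\mathbf n}^2-1)\big)^\top$, $\mathbf R^{(2)}=(1,\gamma v_1,\gamma v_2,\gamma)^\top$, $\mathbf R^{(3)}=(\gamma v_\tau,\ 2H\gamma^2v_\tau v_1-Hn_2,\ 2H\gamma^2v_\tau v_2+Hn_1,\ 2H\gamma^2v_\tau)^\top$. **Mesh.** $\mathcal T_h$ is a conforming triangulation of a 2D domain, every edge of every cell being regarded as shared with a neighbouring cell (e.g. periodic identification). $|K|$ is the area of $K$; $\mathcal E_K^j$, $j=1,2,3$, are its edges with lengths $|\mathcal E_K^j|$ and unit outward normals $\mathbf n_K^{(j)}$; $\boldsymbol x_K^{(jq)}$, $q=1,\dots,Q$, with $Q=2$, are the 2-point Gauss points on $\mathcal E_K^j$ with weights $\omega_1=\omega_2=\frac12$; $\widehat\omega_1=\frac16$. **Scalar WENO operator $\mathcal P_{K_0}$.** For a target cell $K_0$ with barycenter $(x_0,y_0)$, let $K_1,K_2,K_3$ be its three edge neighbours and $K_{i1},K_{i2}$ ($i=1,2,3$) further nearby cells lying in the same sector as $K_i$ (the sectors being cut out by the lines joining the barycenter of $K_0$ to its vertices). Stencils: $\mathbb N_0=\{K_0,K_1,K_2,K_3,K_{11},K_{12},K_{21},K_{22},K_{31},K_{32}\}$, $\mathbb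 N_1=\{K_0,K_1,K_2,K_3\}$, $\mathbb N_{i+1}=\{K_0,K_i,K_{i1},K_{i2}\}$, $i=1,2,3$. Given scalars $\overline u=\{\overline u_K\}$, $\phi_2$ is the polynomial of degree $\le2$ with mean $\overline u_{K_0}$ on $K_0$ minimizing $\sum_{K\in\mathbb N_0}\big|\frac1{|K|}\iint_K\phi_2-\overline u_K\big|^2$, and $\phi_1^{(\ell)}$, $1\le\ell\le4$, is the polynomial of degree $\le1$ with mean $\overline u_{K_0}$ on $K_0$ minimizing $\sum_{K\in\mathbb N_\ell}\big|\frac1{|K|}\iint_K\phi_1^{(\ell)}-\overline u_K\big|^2$ (these least-squares problems are assumed uniquely solvable). With $\gamma_0=0.96$, $\gamma_1=\dots=\gamma_4=0.01$, smoothness indicators $\beta_0=\sum_{|\boldsymbol\alpha|=1}^{2}\iint_{K_0}|K_0|^{|\boldsymbol\alpha|-1}(\mathcal D^{\boldsymbol\alpha}\phi_2)^2dxdy$, $\beta_\ell=\sum_{|\boldsymbol\alpha|=1}\iint_{K_0}(\mathcal D^{\boldsymbol\alpha}\phi_1^{(\ell)})^2dxdy$ ($1\le\ell\le 4$; $\mathcal D^{\boldsymbol\alpha}$ partial derivatives with multi-index $\boldsymbol\alpha$), $\tau=\frac14\sum_{\ell=1}^4|\beta_0-\beta_\ell|$, $\epsilon=|K_0|\max_{K\in\mathbb N_0}|\overline u_K|^2$, $\delta_\ell=\gamma_\ell\big(1+\frac{\tau^2}{(\beta_\ell+\epsilon)^2}\big)$, $\varpi_\ell=\delta_\ell/\sum_{i=0}^4\delta_i$,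 set $$\mathcal P_{K_0}\overline u=\varpi_0\Big(\frac1{\gamma_0}\phi_2-\sum_{\ell=1}^4\frac{\gamma_\ell}{\gamma_0}\phi_1^{(\ell)}\Big)+\sum_{\ell=1}^4\varpi_\ell\phi_1^{(\ell)}$$ (if all $\overline u_K$, $K\in\mathbb N_0$, vanish, all these polynomials are $0$ and $\mathcal P_{K_0}\overline u=0$). **Characteristic reconstruction $\mathcal R_h^k$ ($k=2$).** For each $K_0$ and $j=1,2,3$, with $\mathbf n_j=\mathbf n_{K_0}^{(j)}$ and $\mathbf R_j=\mathbf R_{\mathbf n_j}(\overline{\mathbf U}_{K_0})$, apply $\mathcal P_{K_0}$ componentwise to $\{\mathbf R_j^{-1}\overline{\mathbf U}_s:s\in\mathbb N_0\}$, obtaining a polynomial vector $\mathbf Z^{(j)}$, and put $\mathbf P^{(j)}_{K_0}=\mathbf R_j\mathbf Z^{(j)}$. Then $\mathbf P_{K_0}=\big(\sum_{j=1}^3|K_j|\mathbf P^{(j)}_{K_0}\big)/\sum_{j=1}^3|K_j|$, and $\mathcal R_h^k\overline{\mathbf U}$ is the piecewise polynomial function equal to $\mathbf P_K$ on each $K$. Its cell averages are $\overline{\mathbf U}_K$. **Limiter $\Pi_h$ (with $\varepsilon_D=\varepsilon_g=0$).** Write $\mathbf P_K=(D_K,\boldsymbol m_K,E_K)^\top$ and $\overline{\mathbf U}_K=(\overline D_K,\overline{\boldsymbol m}_K,\overline E_K)^\top$. Step 1: $\widehat D_K=\theta_D(D_K-\overline D_K)+\overline D_K$, $\theta_D=\min\{|\overline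 D_K/(\overline D_K-D_{\min})|,1\}$, where $D_{\min}=\min\{D_K^{(1)},\min_{j,q}D_K(\boldsymbol x_K^{(jq)})\}$, $D_K^{(1)}=\frac{1}{1-2\widehat\omega_1}\big(\overline D_K-\frac23\widehat\omega_1\sum_{j,q}\omega_qD_K(\boldsymbol x_K^{(jq)})\big)$. Step 2: with $\widehat{\mathbf P}_K=(\widehat D_K,\boldsymbol m_K,E_K)^\top$, $\widetilde{\mathbf P}_K=\theta_g(\widehat{\mathbf P}_K-\overline{\mathbf U}_K)+\overline{\mathbf U}_K$, $\theta_g=\min\{|g(\overline{\mathbf U}_K)/(g(\overline{\mathbf U}_K)-g_{\min})|,1\}$, where $g_{\min}=\min\{g(\widehat{\mathbf U}^{(2)}),\min_{j,q}g(\widehat{\mathbf P}_K(\boldsymbol x_K^{(jq)}))\}$, $\widehat{\mathbf U}^{(2)}=\frac1{1-2\widehat\omega_1}\big(\overline{\mathbf U}_K-\frac23\widehat\omega_1\sum_{j,q}\omega_q\widehat{\mathbf P}_K(\boldsymbol x_K^{(jq)})\big)$. When a denominator vanishes the corresponding $\theta$ is $1$. $\Pi_h$ maps the function equal to $\mathbf P_K$ on each $K$ to the function equal to $\widetilde{\mathbf P}_K$ on each $K$. **Operator $\mathbf L_K$.** For $\mathbf U^\pm\in G_u$, with $\sigma_l=\min\{\lambda^{(1)}_{\mathbf n}(\mathbf U^-),\lambda^{(1)}_{\mathbf n}(\mathbf U^+),0\}$ and $\sigma_r=\max\{\lambda^{(4)}_{\mathbf n}(\mathbf U^-),\lambda^{(4)}_{\mathbf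 n}(\mathbf U^+),0\}$, $$\widehat{\mathbf F}^{hll}(\mathbf U^-,\mathbf U^+;\mathbf n)=\frac{\sigma_r\mathbf n\cdot\mathbf F(\mathbf U^-)-\sigma_l\mathbf n\cdot\mathbf F(\mathbf U^+)+\sigma_l\sigma_r(\mathbf U^+-\mathbf U^-)}{\sigma_r-\sigma_l},$$ $$\mathbf L_K(\mathbf U_h)=-\frac1{|K|}\sum_{j=1}^3|\mathcal E_K^j|\sum_{q=1}^Q\omega_q\widehat{\mathbf F}^{hll}\big(\mathbf U_h^{\mathrm{int}(K)}(\boldsymbol x_K^{(jq)}),\mathbf U_h^{\mathrm{ext}(K)}(\boldsymbol x_K^{(jq)});\mathbf n_K^{(j)}\big),$$ where int/ext denote the limits from inside $K$ and from the neighbouring cell. It is understood that the limited edge values of $\Pi_h\mathcal R_h^k\overline{\mathbf U}$ lie in $G_u$, so that $\mathbf L_K$ is defined. *)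

(* Defs.v *)
From mathcomp Require Import all_boot all_order all_algebra.
From mathcomp Require Import all_classical all_reals all_analysis.

Set Implicit Arguments.
Unset Strict Implicit.
Unset Printing Implicit Defensive.

Import Order.TTheory GRing.Theory Num.Theory numFieldNormedType.Exports.

Local Open Scope classical_set_scope.
Local Open Scope ring_scope.

Section States.
Context {R : realType}.

Definition col4 (a b c d : R) : 'cV[R]_4 := \col_i [:: a; b; c; d]`_i.

(* Numerals in 'I_4 are residues mod 4, so 2 and 3 are the last two indices. *)
Definition sD (U : 'cV[R]_4) : R := U 0 0.
Definition sm1 (U : 'cV[R]_4) : R := U 1 0.
Definition sm2 (U : 'cV[R]_4) : R := U 2 0.
Definition sE (U : 'cV[R]_4) : R := U 3 0.

(* The norm of the library on R * R is the sup norm, hence this one. *)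
Definition enorm (x : R * R) : R := Num.sqrt (x.1 ^+ 2 + x.2 ^+ 2).

Definition mnorm (U : 'cV[R]_4) : R := enorm (sm1 U, sm2 U).

Definition gfun (U : 'cV[R]_4) : R :=
  sE U - Num.sqrt (sD U ^+ 2 + mnorm U ^+ 2).

Definition pressure_eq (Gam : R) (U : 'cV[R]_4) (p : R) : R :=
  p / (Gam - 1) - sE U + mnorm U ^+ 2 / (sE U + p)
  + sD U * Num.sqrt (1 - mnorm U ^+ 2 / (sE U + p) ^+ 2).

(* [xget 0 A] is an element of A when there is one, and 0 otherwise; for an
   admissible U the equation has exactly one solution in [0, +oo[. *)
Definition pres (Gam : R) (U : 'cV[R]_4) : R :=
  xget 0 [set p | 0 <= p /\ pressure_eq Gam U p = 0].

Definition vel (Gam : R) (U : 'cV[R]_4) : R * R :=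
  (sm1 U / (sE U + pres Gam U), sm2 U / (sE U + pres Gam U)).

Definition rho (Gam : R) (U : 'cV[R]_4) : R :=
  sD U * Num.sqrt (1 - enorm (vel Gam U) ^+ 2).

Definition Gu (Gam : R) : set 'cV[R]_4 :=
  [set U | [/\ 0 < rho Gam U, 0 < pres Gam U & enorm (vel Gam U) < 1]].

Definition lorentz (Gam : R) (U : 'cV[R]_4) : R :=
  (Num.sqrt (1 - enorm (vel Gam U) ^+ 2))^-1.

Definition enthalpy (Gam : R) (U : 'cV[R]_4) : R :=
  1 + Gam / (Gam - 1) * (pres Gam U / rho Gam U).

Definition flux1 (Gam : R) (U : 'cV[R]_4) : 'cV[R]_4 :=
  let v := vel Gam U in
  col4 (sD U * v.1) (sm1 U * v.1 + pres Gam U) (sm2 U * v.1) (sm1 U).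

Definition flux2 (Gam : R) (U : 'cV[R]_4) : 'cV[R]_4 :=
  let v := vel Gam U in
  col4 (sD U * v.2) (sm1 U * v.2) (sm2 U * v.2 + pres Gam U) (sm2 U).

Definition nflux (Gam : R) (n : R * R) (U : 'cV[R]_4) : 'cV[R]_4 :=
  n.1 *: flux1 Gam U + n.2 *: flux2 Gam U.

Definition sound (Gam : R) (U : 'cV[R]_4) : R :=
  Num.sqrt (Gam * pres Gam U / (rho Gam U * enthalpy Gam U)).

Definition vnormal (Gam : R) (n : R * R) (U : 'cV[R]_4) : R :=
  (vel Gam U).1 * n.1 + (vel Gam U).2 * n.2.

Definition vtangent (Gam : R) (n : R * R) (U : 'cV[R]_4) : R :=
  (vel Gam U).2 * n.1 - (vel Gam U).1 * n.2.

(* The acoustic eigenvalues: s = -1 gives lambda^(1), s = 1 gives lambda^(4). *)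
Definition acoustic (s : R) (Gam : R) (n : R * R) (U : 'cV[R]_4) : R :=
  let cs := sound Gam U in
  let vn := vnormal Gam n U in
  let v2 := enorm (vel Gam U) ^+ 2 in
  (vn * (1 - cs ^+ 2)
   + s * (cs * (lorentz Gam U)^-1
          * Num.sqrt (1 - vn ^+ 2 - (v2 - vn ^+ 2) * cs ^+ 2)))
  / (1 - v2 * cs ^+ 2).

Definition lambda1 : R -> R * R -> 'cV[R]_4 -> R := acoustic (-1).
Definition lambda4 : R -> R * R -> 'cV[R]_4 -> R := acoustic 1.

Definition eigvec_acoustic (lam : R) (Gam : R) (n : R * R) (U : 'cV[R]_4)
    : 'cV[R]_4 :=
  let ga := lorentz Gam U in
  let H := enthalpy Gam U in
  let v := vel Gam U in
  let vn := vnormal Gam n U in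
  let vt := vtangent Gam n U in
  col4 (ga * (vn * lam - 1))
       (H * ga ^+ 2 * (lam * (vn * v.1 - n.1) + vt * n.2))
       (H * ga ^+ 2 * (lam * (vn * v.2 - n.2) - vt * n.1))
       (H * ga ^+ 2 * (vn ^+ 2 - 1)).

Definition eigvec2 (Gam : R) (U : 'cV[R]_4) : 'cV[R]_4 :=
  let ga := lorentz Gam U in
  let v := vel Gam U in
  col4 1 (ga * v.1) (ga * v.2) ga.

Definition eigvec3 (Gam : R) (n : R * R) (U : 'cV[R]_4) : 'cV[R]_4 :=
  let ga := lorentz Gam U in
  let H := enthalpy Gam U in
  let v := vel Gam U in
  let vt := vtangent Gam n U in
  col4 (ga * vt)
       (2 * H * ga ^+ 2 * vt * v.1 - H * n.2)
       (2 * H * ga ^+ 2 * vt * v.2 + H * n.1)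
       (2 * H * ga ^+ 2 * vt).

Definition eigmx (Gam : R) (n : R * R) (U : 'cV[R]_4) : 'M[R]_4 :=
  \matrix_(i, j)
    ([:: eigvec_acoustic (lambda1 Gam n U) Gam n U; eigvec2 Gam U;
         eigvec3 Gam n U; eigvec_acoustic (lambda4 Gam n U) Gam n U]`_j) i 0.

Definition hll (Gam : R) (Um Up : 'cV[R]_4) (n : R * R) : 'cV[R]_4 :=
  let sl := Num.min (Num.min (lambda1 Gam n Um) (lambda1 Gam n Up)) 0 in
  let sr := Num.max (Num.max (lambda4 Gam n Um) (lambda4 Gam n Up)) 0 in
  (sr - sl)^-1 *:
    (sr *: nflux Gam n Um - sl *: nflux Gam n Up + (sl * sr) *: (Up - Um)).

End States.

Section Triangles.
Context {R : realType}.

Definition triangle (v : 'I_3 -> R * R) : set (R * R) :=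
  [set x | exists l : 'I_3 -> R, [/\ forall i, 0 <= l i, \sum_i l i = 1 &
     x = (\sum_i l i * (v i).1, \sum_i l i * (v i).2)]].

Definition segment (a b : R * R) : set (R * R) :=
  [set x | exists2 t : R, 0 <= t <= 1 &
     x = ((1 - t) * a.1 + t * b.1, (1 - t) * a.2 + t * b.2)].

Definition ccw (v : 'I_3 -> R * R) : Prop :=
  0 < ((v 1).1 - (v 0).1) * ((v 2).2 - (v 0).2)
      - ((v 2).1 - (v 0).1) * ((v 1).2 - (v 0).2).

Definition barycenter (v : 'I_3 -> R * R) : R * R :=
  ((\sum_i (v i).1) / 3, (\sum_i (v i).2) / 3).

(* Edge j of a triangle joins vertex j to its successor [ordS j]. *)
Definition edge_vec (v : 'I_3 -> R * R) (j : 'I_3) : R * R := v (ordS j) - v j.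

Definition edge_len (v : 'I_3 -> R * R) (j : 'I_3) : R := enorm (edge_vec v j).

(* Outward when the vertices are listed counterclockwise. *)
Definition edge_normal (v : 'I_3 -> R * R) (j : 'I_3) : R * R :=
  ((edge_vec v j).2 / edge_len v j, - (edge_vec v j).1 / edge_len v j).

(* The part of the plane seen from the barycenter through edge j. *)
Definition sector (v : 'I_3 -> R * R) (j : 'I_3) : set (R * R) :=
  let b := barycenter v in
  let d1 := v j - b in
  let d2 := v (ordS j) - b in
  [set x | exists s t : R, [/\ 0 <= s, 0 <= t &
     x = (b.1 + s * d1.1 + t * d2.1, b.2 + s * d1.2 + t * d2.2)]].

(* Nodes 1/2 -+ 1/(2 sqrt 3) of the 2-point Gauss rule on [0, 1]. *)
Definition gauss_node (q : 'I_2) : R :=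
  2^-1 + (if q == 0 then -1 else 1) * (2 * Num.sqrt 3)^-1.

Definition gauss_weight (q : 'I_2) : R := 2^-1.

Definition gauss_point (v : 'I_3 -> R * R) (j : 'I_3) (q : 'I_2) : R * R :=
  ((v j).1 + gauss_node q * (edge_vec v j).1,
   (v j).2 + gauss_node q * (edge_vec v j).2).

(* Two triangles meet in nothing, in a common vertex or in a common edge. *)
Definition meet_conformingly (v w : 'I_3 -> R * R) : Prop :=
  [\/ triangle v `&` triangle w = set0,
      exists i j, v i = w j /\ triangle v `&` triangle w = [set v i] |
      exists i j, [set v i; v (ordS i)] = [set w j; w (ordS j)] /\
        triangle v `&` triangle w = segment (v i) (v (ordS i))].

Definition area (A : set (R * R)) : R :=
  fine ((@lebesgue_measure R \x @lebesgue_measure R)%E A).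

Definition integral2 (A : set (R * R)) (f : R * R -> R) : R :=
  \int[(@lebesgue_measure R \x @lebesgue_measure R)%E]_(x in A) f x.

Definition mean (A : set (R * R)) (f : R * R -> R) : R :=
  (area A)^-1 * integral2 A f.

Definition is_poly (k : nat) (f : R * R -> R) : Prop :=
  exists c : nat -> nat -> R, forall x,
    f x = \sum_(i < k.+1) \sum_(j < k.+1 - i) c i j * x.1 ^+ i * x.2 ^+ j.

Definition pdx (f : R * R -> R) : R * R -> R :=
  fun x => derive1 (fun s : R => f (s, x.2)) x.1.
Definition pdy (f : R * R -> R) : R * R -> R :=
  fun x => derive1 (fun s : R => f (x.1, s)) x.2.
Definition pd (a b : nat) (f : R * R -> R) : R * R -> R :=
  iter a pdx (iter b pdy f).

End Triangles.

(* Cells are given by vertices in the plane, and [period] is the group of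
   translations by which the plane is identified with itself: it is {0} for a
   mesh without identification, and a lattice for a doubly periodic mesh.  A
   pair (K, t) with t a period stands for the copy K + t of the cell K, which
   carries the same cell average as K. *)
Record mesh (R : realType) := Mesh {
  cell : eqType;
  vtx : cell -> 'I_3 -> R * R;
  period : set (R * R);
  (* the neighbour K_(j+1) of K across its edge j *)
  nbr : cell -> 'I_3 -> cell * (R * R);
  (* the two further cells of the sector of that neighbour *)
  far : cell -> 'I_3 -> 'I_2 -> cell * (R * R);
  pvtx := fun (A : cell * (R * R)) (i : 'I_3) => vtx A.1 i + A.2;
  stencil0 := fun K : cell =>
    (K, 0) :: [seq nbr K i | i <- enum 'I_3]
      ++ [seq far K i a | i <- enum 'I_3, a <- enum 'I_2];
  period0 : period 0;
  periodB : forall s t, period s -> period t -> period (s - t);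
  vtx_ccw : forall K, ccw (vtx K);
  mesh_conforming : forall A B : cell * (R * R), period A.2 -> period B.2 ->
    A != B -> meet_conformingly (pvtx A) (pvtx B);
  nbr_period : forall K j, period (nbr K j).2;
  nbr_edge : forall K j, exists i,
    [set vtx K j; vtx K (ordS j)]
      = [set pvtx (nbr K j) i; pvtx (nbr K j) (ordS i)];
  far_period : forall K j a, period (far K j a).2;
  far_sector : forall K j a, sector (vtx K) j (barycenter (pvtx (far K j a)));
  stencil0_uniq : forall K, uniq (stencil0 K)
}.

Section Scheme.
Context {R : realType} (M : mesh R).
Implicit Types (K : cell M) (u : cell M -> R) (U : cell M -> 'cV[R]_4).

Definition pcell (A : cell M * (R * R)) : set (R * R) := triangle (pvtx A).
Definition base K : set (R * R) := triangle (vtx K).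

(* l = 0 is the stencil made of K and its neighbours; l = i + 1 is the one of
   the sector i. *)
Definition substencil K (l : 'I_4) : seq (cell M * (R * R)) :=
  if unlift ord0 l is Some i then
    [:: (K, 0); nbr K i; far K i 0; far K i 1]
  else (K, 0) :: [seq nbr K i | i <- enum 'I_3].

Definition lsq_error (S : seq (cell M * (R * R))) u (phi : R * R -> R) : R :=
  \sum_(A <- S) `|mean (pcell A) phi - u A.1| ^+ 2.

Definition lsq_fit (k : nat) K (S : seq (cell M * (R * R))) u
    (phi : R * R -> R) : Prop :=
  [/\ is_poly k phi, mean (base K) phi = u K &
      forall psi, is_poly k psi -> mean (base K) psi = u K ->
        lsq_error S u phi <= lsq_error S u psi].

Definition lsq_solvable : Prop := forall K u,
  (exists! phi, lsq_fit 2 K (stencil0 K) u phi) /\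
  (forall l, exists! phi, lsq_fit 1 K (substencil K l) u phi).

Definition lsq_poly (k : nat) K (S : seq (cell M * (R * R))) u : R * R -> R :=
  xget (fun=> 0) [set phi | lsq_fit k K S u phi].

Definition phi2 K u : R * R -> R := lsq_poly 2 K (stencil0 K) u.
Definition phi1 K u (l : 'I_4) : R * R -> R := lsq_poly 1 K (substencil K l) u.

(* Sum over the multi-indices (i, m - i), 1 <= m <= k. *)
Definition smoothness (k : nat) K (phi : R * R -> R) : R :=
  \sum_(1 <= m < k.+1) \sum_(i < m.+1)
    integral2 (base K)
      (fun x => area (base K) ^+ m.-1 * pd i (m - i) phi x ^+ 2).

Definition beta0 K u : R := smoothness 2 K (phi2 K u).
Definition beta K u (l : 'I_4) : R := smoothness 1 K (phi1 K u l).

Definition gamma0 : R := 96 / 100.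
Definition gammal : R := 1 / 100.

Definition tau K u : R := 4^-1 * \sum_(l < 4) `|beta0 K u - beta K u l|.

Definition epsw K u : R :=
  area (base K) * \big[Num.max/0]_(A <- stencil0 K) (`|u A.1| ^+ 2).

(* When u vanishes on the stencil, so do phi2, phi1, beta0, beta and epsw, and
   the quotients below are 0 / 0 = 0: the weights are then the gammas, and
   [weno] is 0 as it should be. *)
Definition delta (gam b : R) K u : R :=
  gam * (1 + tau K u ^+ 2 / (b + epsw K u) ^+ 2).

Definition delta0 K u : R := delta gamma0 (beta0 K u) K u.
Definition deltal K u (l : 'I_4) : R := delta gammal (beta K u l) K u.
Definition delta_sum K u : R := delta0 K u + \sum_(l < 4) deltal K u l.

Definition weno K u : R * R -> R := fun x =>
  delta0 K u / delta_sum K u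
    * (gamma0^-1 * phi2 K u x - \sum_(l < 4) gammal / gamma0 * phi1 K u l x)
  + \sum_(l < 4) deltal K u l / delta_sum K u * phi1 K u l x.

Definition char_poly_vec (Gam : R) U K (j : 'I_3) : R * R -> 'cV[R]_4 :=
  let Rj := eigmx Gam (edge_normal (vtx K) j) (U K) in
  fun x => Rj *m \col_i weno K (fun s => (invmx Rj *m U s) i 0) x.

(* A piecewise polynomial function is the family of its restrictions to the
   cells, each of them extended to the plane. *)
Definition reconstruct (Gam : R) U : cell M -> R * R -> 'cV[R]_4 := fun K x =>
  (\sum_(j < 3) area (pcell (nbr K j)))^-1 *:
    \sum_(j < 3) area (pcell (nbr K j)) *: char_poly_vec Gam U K j x.

Definition omega_hat : R := 1 / 6.

Definition gauss_pt K (j : 'I_3) (q : 'I_2) : R * R :=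
  gauss_point (vtx K) j q.

Definition inner_value (ubar : 'cV[R]_4) K (P : R * R -> 'cV[R]_4)
    : 'cV[R]_4 :=
  (1 - 2 * omega_hat)^-1 *:
    (ubar - (2 / 3 * omega_hat) *:
      \sum_(j < 3) \sum_(q < 2) gauss_weight q *: P (gauss_pt K j q)).

Definition limiter_min (f : 'cV[R]_4 -> R) (ubar : 'cV[R]_4) K
    (P : R * R -> 'cV[R]_4) : R :=
  \big[Num.min/f (inner_value ubar K P)]_(jq : 'I_3 * 'I_2)
    f (P (gauss_pt K jq.1 jq.2)).

Definition theta (fbar fmin : R) : R :=
  if fbar - fmin == 0 then 1 else Num.min `|fbar / (fbar - fmin)| 1.

Definition limit_density (ubar : 'cV[R]_4) K (P : R * R -> 'cV[R]_4)
    : R * R -> 'cV[R]_4 :=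
  let th := theta (sD ubar) (limiter_min sD ubar K P) in
  fun x => col4 (th * (sD (P x) - sD ubar) + sD ubar)
                (sm1 (P x)) (sm2 (P x)) (sE (P x)).

Definition limit_g (ubar : 'cV[R]_4) K (P : R * R -> 'cV[R]_4)
    : R * R -> 'cV[R]_4 :=
  let th := theta (gfun ubar) (limiter_min gfun ubar K P) in
  fun x => th *: (P x - ubar) + ubar.

(* The cell averages of the argument are passed as U. *)
Definition limiter U (P : cell M -> R * R -> 'cV[R]_4)
    : cell M -> R * R -> 'cV[R]_4 :=
  fun K => limit_g (U K) K (limit_density (U K) K (P K)).

(* The copy K' + t of K' carries the translate of the polynomial of K'. *)
Definition ext_value (Uh : cell M -> R * R -> 'cV[R]_4) K (j : 'I_3)
    (x : R * R) : 'cV[R]_4 :=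
  Uh (nbr K j).1 (x - (nbr K j).2).

Definition fv_operator (Gam : R) (Uh : cell M -> R * R -> 'cV[R]_4) K
    : 'cV[R]_4 :=
  - ((area (base K))^-1 *:
    \sum_(j < 3) edge_len (vtx K) j *:
      \sum_(q < 2) gauss_weight q *:
        hll Gam (Uh K (gauss_pt K j q)) (ext_value Uh K j (gauss_pt K j q))
          (edge_normal (vtx K) j)).

Definition limited (Gam : R) U : cell M -> R * R -> 'cV[R]_4 :=
  limiter U (reconstruct Gam U).

Definition evolve (Gam dt : R) U : cell M -> 'cV[R]_4 :=
  fun K => U K + dt *: fv_operator Gam (limited Gam U) K.

End Scheme.

(* Main.v *)
Require Import Defs.
From mathcomp Require Import all_boot all_order all_algebra.
From mathcomp Require Import all_classical all_reals all_analysis.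
From mathcomp Require Import ring lra.
Import Order.TTheory GRing.Theory Num.Theory.
Import numFieldNormedType.Exports.
Local Open Scope ring_scope.

(** Every step of the scheme is homogeneous, of degree 0 or 1, under the scaling
    U |-> z U of the data by z > 0, and the degrees add up to 1.

    Physics.  The pressure equation is homogeneous of degree 1 in (U, p)
    ([pressure_eqZ]), so z p solves it for z U when p solves it for U.  The
    recovered pressure is a chosen solution, hence it scales only because the
    solution is unique on admissible states: there the energy exceeds the
    momentum norm ([Gu_mnorm_lt_energy]), and on such states the equation is
    strictly increasing in p ([pressure_eq_strict_mono]).  Thus pressure and
    density have degree 1 ([presZ]), while velocity, enthalpy, sound speed,
    eigenvalues and the eigenvector matrix have degree 0.  The fluxes, and with
    them the HLL flux of two admissible states, have degree 1 ([hllZ]).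

    Reconstruction.  The least-squares polynomials have degree 1 in the data
    by uniqueness of the minimizers ([lsq_poly_scale]).  The smoothness indicators,
    tau and epsilon are all of degree 2, so tau^2 / (beta + epsilon)^2, hence
    the nonlinear weights, have degree 0, and the WENO polynomial has degree 1
    ([weno_scale]).  It is this matching of degrees, obtained by making epsilon
    depend on the data, that makes the weights insensitive to the scale.  As the
    eigenvector matrices do not change, the characteristic reconstruction has
    degree 1 as well.

    Limiter.  The density and g have degree 1 ([gfunZ]), so the ratios defining
    both theta have degree 0 ([theta_scale]).

    The edge values seen from the neighbouring cell are admissible because the
    Gauss points of a shared edge are the same from both sides
    ([gauss_point_shared_edge]). *)

Set Implicit Arguments.
Unset Strict Implicit.
Unset Printing Implicit Defensive.

Lemma scale_swap (R : comPzRingType) (V : lmodType R) (a b : R) (v : V) :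
  a *: (b *: v) = b *: (a *: v).
Proof. by rewrite !scalerA mulrC. Qed.

(** * Homogeneity of derivatives and integrals *)

Section Analysis.
Local Open Scope classical_set_scope.

(** The limit of a filter that does not converge is the default point 0, which
    is fixed by scaling; so the rule holds at points of non-derivability too. *)
Lemma derive1_scale (R : realType) (z : R) (f : R -> R) (x : R) : z != 0 ->
  derive1 (fun y => z * f y) x = z * derive1 f x.
Proof.
move=> z0; rewrite /derive1.
have -> : (fun h : R => h^-1 *: (z * f (h + x) - z * f x)) =
          z *: (fun h : R => h^-1 *: (f (h + x) - f x)).
  by apply/funext => h /=; rewrite -mulrBr; exact: mulrCA.
have [cf|dvgf] := pselect (cvg (h^-1 *: (f (h + x) - f x) @[h --> 0^'])).
  by rewrite (limZl_tmp z cf).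
have dvgzf : ~ cvg ((z *: (fun h : R => h^-1 *: (f (h + x) - f x))) @ 0^').
  by rewrite is_cvgZlE//; exact: dvgf.
by rewrite (dvgP dvgf) (dvgP dvgzf) [RHS]mulr0.
Qed.

Section IntegralScale.
Local Open Scope ereal_scope.
Import HBNNSimple.

(** The map h |-> z h exchanges the simple functions below f with those below
    z f.  Since no approximation of f by simple functions is involved, the
    resulting scaling rule covers arbitrary integrands and domains. *)
Lemma sup_sintegral_scale d (T : measurableType d) (R : realType)
    (mu : {measure set T -> \bar R}) (z : R) (f g : T -> \bar R) :
    (0 < z)%R -> (forall x, g x = z%:E * f x) ->
  ereal_sup [set sintegral mu h |
    h in [set h : {nnsfun T >-> R} | forall x, (h x)%:E <= g x]] =
  z%:E * ereal_sup [set sintegral mu h |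
    h in [set h : {nnsfun T >-> R} | forall x, (h x)%:E <= f x]].
Proof.
move=> z0 gE; rewrite -ereal_sup_pZl//; congr ereal_sup; apply/seteqP; split.
- move=> _ [h hg <-] /=.
  have zV0 : (0 <= z^-1)%R by rewrite invr_ge0 ltW.
  exists (sintegral mu (scale_nnsfun h zV0)).
    exists (scale_nnsfun h zV0) => // x /=.
    by rewrite EFinM lee_pdivrMl// -gE; exact: hg.
  rewrite (_ : sintegral mu _ = z^-1%:E * sintegral mu h).
    by rewrite muleA -EFinM divff ?gt_eqF// mul1e.
  exact: sintegralrM.
- move=> _ [_ [h hf <-] <-] /=.
  exists (scale_nnsfun h (ltW z0)); last exact: sintegralrM.
  by move=> x /=; rewrite EFinM gE lee_pmul2l//; exact: hf.
Qed.

Lemma integral_scale d (T : measurableType d) (R : realType)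
    (mu : {measure set T -> \bar R}) (D : set T) (z : R) (f : T -> \bar R) :
  (0 < z)%R -> \int[mu]_(x in D) (z%:E * f x) = z%:E * \int[mu]_(x in D) f x.
Proof.
move=> z0.
have restrictE : (fun x => z%:E * f x) \_ D = (fun x => z%:E * (f \_ D) x).
  by apply/funext => x; rewrite /patch; case: ifP => // _; rewrite mule0.
rewrite /integral restrictE ge0_funeposM ?ge0_funenegM ?(ltW z0)//.
rewrite (sup_sintegral_scale mu z0
  (g := fun x => z%:E * (f \_ D)^\+ x) (f := (f \_ D)^\+))//.
rewrite (sup_sintegral_scale mu z0
  (g := fun x => z%:E * (f \_ D)^\- x) (f := (f \_ D)^\-))//.
have yz : z%:E * +oo = +oo by rewrite gt0_muley ?lte_fin.
have Nyz : z%:E * -oo = -oo by rewrite gt0_muleNy ?lte_fin.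
(* When both suprema are infinite, their difference is -oo, which scaling
   preserves as well. *)
case: ereal_sup => [a| |]; case: ereal_sup => [b| |] => /=;
  rewrite ?(yz, Nyz) //=.
by rewrite -EFinD -!EFinM mulrDr mulrN.
Qed.
End IntegralScale.

Lemma fine_scale (R : realType) (z : R) (x : \bar R) : 0 < z ->
  fine (z%:E * x)%E = z * fine x.
Proof.
move=> z0; case: x => [a| |] //=.
- by rewrite gt0_muley ?lte_fin// mulr0.
- by rewrite gt0_muleNy ?lte_fin// mulr0.
Qed.
End Analysis.

(** * Recovery of the pressure from the conservative state *)

Section Recovery.
Variable R : realType.
Implicit Types (U : 'cV[R]_4) (z p q Gam : R) (x n : R * R).

Lemma sqr_enorm x : enorm x ^+ 2 = x.1 ^+ 2 + x.2 ^+ 2.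
Proof. by rewrite sqr_sqrtr// addr_ge0 ?sqr_ge0. Qed.

Lemma sqr_mnorm U : mnorm U ^+ 2 = sm1 U ^+ 2 + sm2 U ^+ 2.
Proof. exact: sqr_enorm. Qed.

Lemma sDZ z U : sD (z *: U) = z * sD U.
Proof. by rewrite /sD mxE. Qed.

Lemma sm1Z z U : sm1 (z *: U) = z * sm1 U.
Proof. by rewrite /sm1 mxE. Qed.

Lemma sm2Z z U : sm2 (z *: U) = z * sm2 U.
Proof. by rewrite /sm2 mxE. Qed.

Lemma sEZ z U : sE (z *: U) = z * sE U.
Proof. by rewrite /sE mxE. Qed.

Lemma col4Z z (a b c d : R) :
  col4 (z * a) (z * b) (z * c) (z * d) = z *: col4 a b c d.
Proof.
apply/colP => i; rewrite !mxE.
by case: i => [[|[|[|[|i]]]]] //= _.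
Qed.

Lemma sqrt_scale z p : 0 <= z -> Num.sqrt (z ^+ 2 * p) = z * Num.sqrt p.
Proof. by move=> z0; rewrite sqrtrM ?sqr_ge0// sqrtr_sqr ger0_norm. Qed.

Lemma mnormZ z U : 0 <= z -> mnorm (z *: U) = z * mnorm U.
Proof.
by move=> z0; rewrite /mnorm /enorm /= sm1Z sm2Z !exprMn -mulrDr sqrt_scale.
Qed.

Lemma gfunZ z U : 0 <= z -> gfun (z *: U) = z * gfun U.
Proof.
move=> z0.
by rewrite /gfun sEZ sDZ mnormZ// !exprMn -mulrDr sqrt_scale// mulrBr.
Qed.

Lemma pressure_eqZ Gam z U p : 0 < z ->
  pressure_eq Gam (z *: U) (z * p) = z * pressure_eq Gam U p.
Proof.
move=> z0; have zn0 : z != 0 by rewrite gt_eqF.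
rewrite /pressure_eq sEZ sDZ (mnormZ _ (ltW z0)) -mulrDr !exprMn.
rewrite -[_ / (z ^+ 2 * _)]mulf_div divff ?expf_neq0// mul1r.
have -> : z ^+ 2 * mnorm U ^+ 2 / (z * (sE U + p)) =
          z * (mnorm U ^+ 2 / (sE U + p)).
  by rewrite -mulf_div expr2 mulfK.
by rewrite !mulrDr mulrN !mulrA.
Qed.

(** The term p / (Gam - 1) has slope at least 1, as Gam <= 2, whereas
    |m|^2 / (E + p) decreases with slope above -1, as E + p > |m|; the square
    root is nondecreasing in p. *)
Lemma pressure_eq_strict_mono Gam U p q : 1 < Gam <= 2 -> 0 <= sD U ->
  mnorm U < sE U -> 0 <= p -> p < q -> pressure_eq Gam U p < pressure_eq Gam U q.
Proof.
move=> /andP[G1 G2] D0 mE p0 pq; rewrite /pressure_eq.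
have m0 : 0 <= mnorm U by exact: sqrtr_ge0.
move: (mnorm U) (sE U) (sD U) m0 mE D0 => m E D m0 mE D0.
have a0 : 0 < E + p by lra.
have b0 : 0 < E + q by lra.
have ma : m < E + p by lra.
have mb : m < E + q by lra.
have step1 : q - p <= q / (Gam - 1) - p / (Gam - 1).
  rewrite -mulrBl ler_pdivlMr; first nra.
  by lra.
have step2 : m ^+ 2 / (E + p) - m ^+ 2 / (E + q) < q - p.
  have -> : m ^+ 2 / (E + p) - m ^+ 2 / (E + q) =
            (m ^+ 2 / ((E + p) * (E + q))) * (q - p).
    by field; rewrite !gt_eqF.
  rewrite -[ltRHS]mul1r ltr_pM2r ?subr_gt0// ltr_pdivrMr ?mulr_gt0// mul1r expr2.
  exact: ltr_pM.
have step3 : D * Num.sqrt (1 - m ^+ 2 / (E + p) ^+ 2) <=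
             D * Num.sqrt (1 - m ^+ 2 / (E + q) ^+ 2).
  apply: ler_wpM2l => //; apply: ler_wsqrtr; rewrite lerD2l lerN2.
  apply: ler_wpM2l; first exact: sqr_ge0.
  by rewrite lef_pV2 ?posrE ?exprn_gt0// ler_sqr ?nnegrE; lra.
lra.
Qed.

Lemma Gu_pres_root Gam U : Gu Gam U ->
  0 <= pres Gam U /\ pressure_eq Gam U (pres Gam U) = 0.
Proof.
case=> _ p0 _; move: p0; rewrite /pres.
by case: xgetP => [p _ //|_]; rewrite ltxx.
Qed.

Lemma Gu_density_gt0 Gam U : Gu Gam U -> 0 < sD U.
Proof.
case=> r0 _ _; rewrite ltNge; apply/negP => D0; move: r0.
by rewrite /rho ltNge => /negP; apply; rewrite mulr_le0_ge0// sqrtr_ge0.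
Qed.

(** With s = E + p and |v| = |m| / s, the pressure equation reads
    s (1 - |v|^2) = Gam / (Gam - 1) p + D sqrt (1 - |v|^2), where the right-hand
    side is at least 2 p as Gam <= 2; in particular s > 0.  Dividing by
    1 + |v| < 2 gives s (1 - |v|) > p, which is E > |m|. *)
Lemma Gu_mnorm_lt_energy Gam U : 1 < Gam <= 2 -> Gu Gam U -> mnorm U < sE U.
Proof.
move=> /andP[G1 G2] GU; have D0 := Gu_density_gt0 GU.
have [_ root] := Gu_pres_root GU; case: GU => _ p0 w1.
have w0 : 0 <= enorm (vel Gam U) by exact: sqrtr_ge0.
have wE : enorm (vel Gam U) ^+ 2 = mnorm U ^+ 2 / (sE U + pres Gam U) ^+ 2.
  by rewrite sqr_enorm sqr_mnorm /vel /= !expr_div_n -mulrDl.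
have m0 : 0 <= mnorm U by exact: sqrtr_ge0.
move: root wE; rewrite /pressure_eq.
move: (enorm _) (mnorm U) (sE U) (pres Gam U) (sD U) D0 p0 w1 w0 m0.
move=> w m E p D D0 p0 w1 w0 m0 root wE.
have c0 := sqrtr_ge0 (1 - m ^+ 2 / (E + p) ^+ 2).
move: root c0; set c := Num.sqrt _ => root c0.
have Dc0 : 0 <= D * c by rewrite mulr_ge0// ltW.
have pG : p <= p / (Gam - 1).
  rewrite ler_pdivlMr; first nra.
  by lra.
(* At E + p = 0 the quotients are 0, which leaves a sum of positive terms. *)
have sn0 : E + p != 0.
  by apply/eqP => s0; move: root; rewrite s0 invr0 mulr0; lra.
have mw : m ^+ 2 / (E + p) = (E + p) * w ^+ 2 by rewrite wE; field.
have m2 : m ^+ 2 = ((E + p) * w) ^+ 2.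
  by rewrite exprMn wE; field.
rewrite mw in root.
have w2 : 0 < 1 - w ^+ 2 by rewrite subr_gt0 expr_lt1.
have sw : 2 * p <= (E + p) * (1 - w ^+ 2) by lra.
have s0 : 0 < E + p by rewrite -(pmulr_lgt0 _ w2); lra.
have -> : m = (E + p) * w.
  by apply/eqP; rewrite -(eqrXn2 (n := 2))// ?m2// mulr_ge0// ltW.
nra.
Qed.

Lemma presZ Gam z U : 1 < Gam <= 2 -> Gu Gam U -> 0 < z ->
  pres Gam (z *: U) = z * pres Gam U.
Proof.
move=> hG GU z0; have [p0 root] := Gu_pres_root GU.
apply: xget_subset1 => [|p q [hp rp] [hq rq]].
  by split; [rewrite mulr_ge0// ltW|rewrite pressure_eqZ// root mulr0].
have D0 : 0 <= sD (z *: U) by rewrite sDZ mulr_ge0// ltW// (Gu_density_gt0 GU).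
have mE : mnorm (z *: U) < sE (z *: U).
  by rewrite mnormZ ?ltW// sEZ ltr_pM2l// (Gu_mnorm_lt_energy hG GU).
have [pq|qp|//] := ltgtP p q.
- by have := pressure_eq_strict_mono hG D0 mE hp pq; rewrite rp rq ltxx.
- by have := pressure_eq_strict_mono hG D0 mE hq qp; rewrite rp rq ltxx.
Qed.

End Recovery.

(** * Invariance of the eigenstructure, homogeneity of the fluxes *)

Section Invariance.
Variables (R : realType) (Gam z : R) (U : 'cV[R]_4).
Hypotheses (hG : 1 < Gam <= 2) (GU : Gu Gam U) (z0 : 0 < z).
Implicit Types (n : R * R) (s : R).

Lemma velZ : vel Gam (z *: U) = vel Gam U.
Proof.
rewrite /vel presZ// sEZ sm1Z sm2Z -mulrDr.
by rewrite -!mulf_div divff ?gt_eqF// !mul1r.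
Qed.

Lemma rhoZ : rho Gam (z *: U) = z * rho Gam U.
Proof. by rewrite /rho velZ sDZ mulrA. Qed.

Lemma enthalpyZ : enthalpy Gam (z *: U) = enthalpy Gam U.
Proof.
by rewrite /enthalpy presZ// rhoZ -mulf_div divff ?gt_eqF// mul1r.
Qed.

Lemma soundZ : sound Gam (z *: U) = sound Gam U.
Proof.
rewrite /sound presZ// rhoZ enthalpyZ mulrCA -mulrA.
by rewrite -mulf_div divff ?gt_eqF// mul1r.
Qed.

Lemma acousticZ s n : acoustic s Gam n (z *: U) = acoustic s Gam n U.
Proof. by rewrite /acoustic /lorentz /vnormal soundZ velZ. Qed.

Lemma eigmxZ n : eigmx Gam n (z *: U) = eigmx Gam n U.
Proof.
rewrite /eigmx /eigvec_acoustic /eigvec2 /eigvec3 /lambda1 /lambda4 !acousticZ.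
by rewrite /lorentz /vnormal /vtangent velZ enthalpyZ.
Qed.

Lemma nfluxZ n : nflux Gam n (z *: U) = z *: nflux Gam n U.
Proof.
rewrite /nflux /flux1 /flux2 velZ presZ// sDZ sm1Z sm2Z -!mulrA -!mulrDr.
by rewrite !col4Z scalerDr !scalerA [n.1 * z]mulrC [n.2 * z]mulrC.
Qed.

End Invariance.

Lemma hllZ (R : realType) (Gam z : R) (Um Up : 'cV[R]_4) (n : R * R) :
    1 < Gam <= 2 -> Gu Gam Um -> Gu Gam Up -> 0 < z ->
  hll Gam (z *: Um) (z *: Up) n = z *: hll Gam Um Up n.
Proof.
move=> hG Gm Gp z0; rewrite /hll /lambda1 /lambda4 !acousticZ// !nfluxZ//.
set sl := Num.min _ _; set sr := Num.max _ _.
rewrite -scalerBr !scalerA [sr * z]mulrC [sl * z]mulrC [sl * sr * z]mulrC.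
by rewrite -!scalerA -scalerBr -scalerDr !scalerA [_ * z]mulrC.
Qed.

(** * Homogeneity of the WENO reconstruction *)

Section Reconstruction.
Variables (R : realType) (M : mesh R) (z : R).
Hypothesis z0 : 0 < z.
Implicit Types (K : cell M) (u : cell M -> R) (f phi : R * R -> R).

Lemma integral2_scale (A : set (R * R)) f :
  integral2 A (fun x => z * f x) = z * integral2 A f.
Proof. by rewrite /integral2 /Rintegral -fine_scale// -integral_scale. Qed.

Lemma mean_scale (A : set (R * R)) f :
  mean A (fun x => z * f x) = z * mean A f.
Proof. by rewrite /mean integral2_scale mulrCA. Qed.

Lemma is_poly_scale k f : is_poly k f -> is_poly k (fun x => z * f x).
Proof.
case=> c fE; exists (fun i j => z * c i j) => x; rewrite fE mulr_sumr.
apply: eq_bigr => i _; rewrite mulr_sumr; apply: eq_bigr => j _.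
by rewrite !mulrA.
Qed.

Lemma lsq_error_scale (S : seq (cell M * (R * R))) u phi :
  lsq_error S (fun K => z * u K) (fun x => z * phi x) =
  z ^+ 2 * lsq_error S u phi.
Proof.
rewrite /lsq_error mulr_sumr; apply: eq_bigr => A _.
by rewrite mean_scale -mulrBr normrM exprMn (gtr0_norm z0).
Qed.

Lemma pdx_scale f : pdx (fun x => z * f x) = fun x => z * pdx f x.
Proof. by apply/funext => x; rewrite /pdx derive1_scale ?gt_eqF. Qed.

Lemma pdy_scale f : pdy (fun x => z * f x) = fun x => z * pdy f x.
Proof. by apply/funext => x; rewrite /pdy derive1_scale ?gt_eqF. Qed.

Lemma pd_scale a b f : pd a b (fun x => z * f x) = fun x => z * pd a b f x.
Proof.
rewrite /pd.
have -> : iter b pdy (fun x => z * f x) = fun x => z * iter b pdy f x.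
  by elim: b => // b IH; rewrite !iterS IH pdy_scale.
by elim: a => // a IH; rewrite !iterS IH pdx_scale.
Qed.

End Reconstruction.

Section Weno.
Variables (R : realType) (M : mesh R) (z : R).
Hypotheses (hM : lsq_solvable M) (z0 : 0 < z).
Implicit Types (K : cell M) (u : cell M -> R) (f phi : R * R -> R).

(** A competitor psi for the scaled data is z times the competitor z^-1 psi for
    the original data, and the error is quadratic. *)
Lemma lsq_fit_scale k K (S : seq (cell M * (R * R))) u phi :
  lsq_fit k K S u phi ->
  lsq_fit k K S (fun K => z * u K) (fun x => z * phi x).
Proof.
case=> hp hm hmin; split; [exact: is_poly_scale|by rewrite mean_scale// hm|].
move=> psi psip psim; rewrite lsq_error_scale//.
have zV0 : 0 < z^-1 by rewrite invr_gt0.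
have zK : (fun x => z * (z^-1 * psi x)) = psi.
  by apply/funext => x; rewrite mulrA divff ?gt_eqF// mul1r.
rewrite -[X in _ <= lsq_error _ _ X]zK lsq_error_scale// ler_pM2l ?exprn_gt0//.
apply: hmin; first exact: is_poly_scale.
by rewrite mean_scale// psim mulrA mulVf ?gt_eqF// mul1r.
Qed.

Lemma lsq_poly_scale k K (S : seq (cell M * (R * R))) u :
    (exists phi, lsq_fit k K S u phi) ->
    (exists! phi, lsq_fit k K S (fun K => z * u K) phi) ->
  lsq_poly k K S (fun K => z * u K) = fun x => z * lsq_poly k K S u x.
Proof.
move=> ex [phi [_ uniq_phi]].
have fit := @xgetPex _ (fun=> 0) [set phi | lsq_fit k K S u phi]%classic ex.
apply: xget_subset1 => [|f g /uniq_phi <- /uniq_phi <-//].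
exact: lsq_fit_scale.
Qed.

Lemma phi2_scale K u : phi2 K (fun K => z * u K) = fun x => z * phi2 K u x.
Proof.
have [[phi [fit _]] _] := hM K u.
by apply: lsq_poly_scale; [exists phi|case: (hM K (fun K => z * u K))].
Qed.

Lemma phi1_scale K u l :
  phi1 K (fun K => z * u K) l = fun x => z * phi1 K u l x.
Proof.
have [_ /(_ l) [phi [fit _]]] := hM K u.
by apply: lsq_poly_scale; [exists phi|case: (hM K (fun K => z * u K))].
Qed.

Lemma smoothness_scale k K phi :
  smoothness k K (fun x => z * phi x) = z ^+ 2 * smoothness k K phi.
Proof.
rewrite /smoothness mulr_sumr; apply: eq_bigr => m _.
rewrite mulr_sumr; apply: eq_bigr => i _.
rewrite -integral2_scale ?exprn_gt0// pd_scale//.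
by congr integral2; apply/funext => x; rewrite exprMn mulrCA.
Qed.

Lemma beta0_scale K u : beta0 K (fun K => z * u K) = z ^+ 2 * beta0 K u.
Proof. by rewrite /beta0 phi2_scale smoothness_scale. Qed.

Lemma beta_scale K u l : beta K (fun K => z * u K) l = z ^+ 2 * beta K u l.
Proof. by rewrite /beta phi1_scale smoothness_scale. Qed.

Lemma tau_scale K u : tau K (fun K => z * u K) = z ^+ 2 * tau K u.
Proof.
rewrite /tau [RHS]mulrCA [in RHS]mulr_sumr; congr (_ * _).
apply: eq_bigr => l _.
by rewrite beta0_scale beta_scale -mulrBr normrM ger0_norm ?sqr_ge0.
Qed.

Lemma epsw_scale K u : epsw K (fun K => z * u K) = z ^+ 2 * epsw K u.
Proof.
rewrite /epsw [RHS]mulrCA; congr (_ * _).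
rewrite (big_morph (fun y => z ^+ 2 * y) (id1 := 0) (op1 := Num.max)) ?mulr0//.
  by apply: eq_bigr => A _; rewrite normrM exprMn (gtr0_norm z0).
by move=> a b; rewrite maxr_pMr ?sqr_ge0.
Qed.

(** Numerator and denominator of the correction are both of degree 4.  When
    b + epsw vanishes, the quotient is 0 on both sides. *)
Lemma delta_scale gam b K u :
  delta gam (z ^+ 2 * b) K (fun K => z * u K) = delta gam b K u.
Proof.
have zn0 : (z ^+ 2) ^+ 2 != 0 by rewrite !expf_neq0// gt_eqF.
by rewrite /delta tau_scale epsw_scale -mulrDr !(exprMn _ (z ^+ 2)) -mulf_div
           divff// mul1r.
Qed.

Lemma weno_scale K u x : weno K (fun K => z * u K) x = z * weno K u x.
Proof.
have d0 : delta0 K (fun K => z * u K) = delta0 K u.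
  by rewrite /delta0 beta0_scale delta_scale.
have dl l : deltal K (fun K => z * u K) l = deltal K u l.
  by rewrite /deltal beta_scale delta_scale.
have ds : delta_sum K (fun K => z * u K) = delta_sum K u.
  by rewrite /delta_sum d0 (eq_bigr _ (fun l _ => dl l)).
rewrite /weno d0 ds phi2_scale [RHS]mulrDr; congr (_ + _).
  rewrite [RHS]mulrCA; congr (_ * _); rewrite mulrBr mulr_sumr.
  rewrite [in LHS]mulrCA; congr (_ - _); apply: eq_bigr => l _.
  by rewrite phi1_scale mulrCA.
rewrite mulr_sumr; apply: eq_bigr => l _.
by rewrite phi1_scale dl mulrCA.
Qed.

End Weno.

(** * Homogeneity of the limiter *)

Section Limiter.
Variables (R : realType) (M : mesh R) (z : R).
Hypothesis z0 : 0 < z.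
Implicit Types (K : cell M) (P : R * R -> 'cV[R]_4) (ubar : 'cV[R]_4).

Lemma inner_value_scale ubar K P :
  inner_value (z *: ubar) K (fun x => z *: P x) = z *: inner_value ubar K P.
Proof.
rewrite /inner_value.
have -> : \sum_(j < 3) \sum_(q < 2) gauss_weight q *: (z *: P (gauss_pt K j q)) =
  z *: \sum_(j < 3) \sum_(q < 2) gauss_weight q *: P (gauss_pt K j q).
  rewrite scaler_sumr; apply: eq_bigr => j _.
  by rewrite scaler_sumr; apply: eq_bigr => q _; exact: scale_swap.
by rewrite [_ *: (z *: _)]scale_swap -scalerBr scale_swap.
Qed.

Lemma limiter_min_scale (f : 'cV[R]_4 -> R) ubar K P :
    (forall V, f (z *: V) = z * f V) ->
  limiter_min f (z *: ubar) K (fun x => z *: P x) = z * limiter_min f ubar K P.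
Proof.
move=> fZ; rewrite /limiter_min inner_value_scale fZ.
rewrite (big_morph (fun y => z * y) (id1 := z * f (inner_value ubar K P))
  (op1 := Num.min)) //.
  by apply: eq_bigr => jq _; rewrite fZ.
by move=> a b; rewrite minr_pMr ?ltW.
Qed.

Lemma theta_scale (a b : R) : theta (z * a) (z * b) = theta a b.
Proof.
have zn0 : z != 0 by rewrite gt_eqF.
rewrite /theta -mulrBr mulf_eq0 (negPf zn0) /=.
by rewrite -mulf_div divff// mul1r.
Qed.

Lemma limit_density_scale ubar K P :
  limit_density (z *: ubar) K (fun x => z *: P x) =
  fun x => z *: limit_density ubar K P x.
Proof.
apply/funext => x; rewrite /limit_density limiter_min_scale; last exact: sDZ.
rewrite !sDZ sm1Z sm2Z sEZ theta_scale -col4Z -mulrBr; congr col4.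
by rewrite mulrCA -mulrDr.
Qed.

Lemma limit_g_scale ubar K P :
  limit_g (z *: ubar) K (fun x => z *: P x) = fun x => z *: limit_g ubar K P x.
Proof.
have gZ V : gfun (z *: V) = z * gfun V by rewrite gfunZ ?ltW.
apply/funext => x; rewrite /limit_g limiter_min_scale// gZ theta_scale.
by rewrite -scalerBr scale_swap -scalerDr.
Qed.

End Limiter.

(** * Gauss points of a shared edge *)

Section Edges.
Variables (R : realType).
Implicit Types (v w : 'I_3 -> R * R).

Lemma set2_eq (T : Type) (a b c d : T) : [set a; b]%classic = [set c; d]%classic ->
  (a = c /\ b = d) \/ (a = d /\ b = c).
Proof.
move=> E.
have ha : [set c; d]%classic a by rewrite -E; left.
have hb : [set c; d]%classic b by rewrite -E; right.
have hc : [set a; b]%classic c by rewrite E; left.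
have hd : [set a; b]%classic d by rewrite E; right.
case: ha => /= ha; case: hb => /= hb; case: hc => /= hc; case: hd => /= hd;
  subst; by [left|right].
Qed.

Lemma gauss_node_rev (q : 'I_2) : gauss_node (rev_ord q) = 1 - gauss_node q :> R.
Proof.
rewrite /gauss_node -!val_eqE /=.
by case: q => [[|[|q]]] //= _; lra.
Qed.

(** The two cells may list the ends of the edge in either order; in the
    reversed order the Gauss nodes are exchanged. *)
Lemma gauss_point_shared_edge v w (t : R * R) (i j : 'I_3) (q : 'I_2) :
    [set v j; v (ordS j)]%classic = [set w i + t; w (ordS i) + t]%classic ->
  exists q', gauss_point v j q - t = gauss_point w i q'.
Proof.
move=> E; case: (set2_eq E) => -[vj vSj]; [exists q|exists (rev_ord q)];
  rewrite /gauss_point /edge_vec vj vSj ?gauss_node_rev;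
  case: t {E vj vSj} => t1 t2; case: (w i) => a1 a2; case: (w (ordS i)) => b1 b2;
  by congr pair => /=; ring.
Qed.

End Edges.

(** * The full scheme *)

Section Scheme.
Variables (R : realType) (M : mesh R) (Gam z : R).
Hypotheses (hM : lsq_solvable M) (hG : 1 < Gam <= 2) (z0 : 0 < z).
Variable U : cell M -> 'cV[R]_4.
Hypothesis hU : forall K, Gu Gam (U K).

Lemma reconstruct_scale K :
  reconstruct Gam (fun K => z *: U K) K =
  fun x => z *: reconstruct Gam U K x.
Proof.
apply/funext => x; rewrite /reconstruct [RHS]scale_swap; congr (_ *: _).
rewrite scaler_sumr; apply: eq_bigr => j _.
rewrite [RHS]scale_swap; congr (_ *: _).
rewrite /char_poly_vec eigmxZ// scalemxAr; congr (_ *m _).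
apply/colP => i; rewrite !mxE -weno_scale//.
congr (weno K _ x); apply/funext => s.
by rewrite -scalemxAr mxE.
Qed.

Lemma limited_scale K :
  limited Gam (fun K => z *: U K) K = fun x => z *: limited Gam U K x.
Proof.
rewrite /limited /limiter reconstruct_scale limit_density_scale//.
by rewrite limit_g_scale.
Qed.

End Scheme.

Theorem theorem3p2 (R : realType) (Gam : R) (hGam : 1 < Gam <= 2)
  (M : mesh R) (hM : lsq_solvable M)
  (dt : R) (hdt : 0 < dt)
  (U : cell M -> 'cV[R]_4) (hU : forall K : cell M, Gu Gam (U K))
  (hedge : forall (K : cell M) (j : 'I_3) (q : 'I_2),
     Gu Gam (limited Gam U K (gauss_pt K j q)))
  (zeta : R) (hzeta : 0 < zeta) :
  (fun K : cell M => zeta^-1 *: evolve Gam dt (fun K' => zeta *: U K') K)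
  = evolve Gam dt U.
Proof.
apply/funext => K; rewrite /evolve.
suff -> : fv_operator Gam (limited Gam (fun K' => zeta *: U K')) K =
          zeta *: fv_operator Gam (limited Gam U) K.
  rewrite [dt *: _]scale_swap -scalerDr scalerA mulVf ?gt_eqF//.
  by rewrite scale1r.
rewrite /fv_operator scalerN [in RHS]scale_swap; congr (- (_ *: _)).
rewrite scaler_sumr; apply: eq_bigr => j _.
rewrite [RHS]scale_swap; congr (_ *: _).
rewrite scaler_sumr; apply: eq_bigr => q _.
rewrite [RHS]scale_swap; congr (_ *: _).
rewrite /ext_value !limited_scale// hllZ//.
(* The neighbour's trace is one of its own limited Gauss values, up to the
   period, hence admissible by [hedge]. *)
have [i edgeE] := nbr_edge K j.
have [q' ->] := gauss_point_shared_edge q edgeE.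
exact: hedge.
Qed.
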